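(* Let $n\ge 1$ and suppose $f\in\mathrm{Sym}_n$ is dominated by the Schur polynomial $s_\lambda(x_1,\dots,x_n)$. Then $\mathrm{Trop}(f)=\mathrm{Trop}(s_\lambda)$ as tropical polynomials over the tropical semiring $(\mathbb{R},\oplus,\odot)$. Therefore, $\mathrm{Trop}(f)$ has at most $O(n^2\cdot\lambda_1)$ tropical semiring complexity, i.e. there is an absolute constant $C$ (independent of $n,f,\lambda$) such that the tropical semiring complexity of $\mathrm{Trop}(f)$ is at most $C\,n^2\lambda_1$.
   Context: $\mathrm{Sym}_n$ is the ring of symmetric polynomials in $x_1,\dots,x_n$ over $\mathbb{C}$. For a partition $\mu$, the Schur polynomial is $s_\mu(x_1,\dots,x_n)=\sum_T x^T$, the sum over semistandard Young tableaux $T$ of shape $\mu$ with entries in $\{1,\dots,n\}$, where $x^T=\prod_i x_i^{\#i\text{'s in }T}$ (it is $0$ if $\mu$ has more than $n$ parts). $\mathrm{Par}(d)$ is the set of partitions of $d$. Dominance order on $\mathrm{Par}(d)$: $\mu\le_D\lambda$ if $\sum_{i=1}^k\mu_i\le\sum_{i=1}^k\lambda_i$ for all $k\ge1$. Dominated: suppose $f\in\mathrm{Sym}_n$ is homogeneous of degree $d$ and $f=\sum_{\mu\in\mathrm{Par}(d)}c_\mu s_\mu$ with $c_\mu\ge0$ for all $\mu$, and suppose $\lambda\in \mathrm{Par}(d)$ is such that $c_\lambda\ne0$ and $c_\mu\neq0$ only if $\mu\le_D\lambda$. Then $f$ is said to be dominated by $s_\lambda$. The tropical semiring has operations $a\oplus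 b=\max(a,b)$ and $a\odot b=a+b$. The tropicalization (with respect to the trivial valuation) of $f=\sum c_{i_1,\dots,i_n}x_1^{i_1}\cdots x_n^{i_n}\in\mathbb{C}[x_1,\dots,x_n]$ is the tropical polynomial $$\mathrm{Trop}(f)=\max\{i_1x_1+\cdots+i_nx_n : c_{i_1,\dots,i_n}\ne 0\}=\bigoplus_{c_{i_1,\dots,i_n}\neq 0}x_1^{\odot i_1}\odot\cdots\odot x_n^{\odot i_n}.$$ By convention the tropicalization of the zero polynomial is the constant $-\infty$ (the empty tropical sum), which is allowed as a constant input below. Equality as tropical polynomials means that the two expressions can be shown equal using the semiring axioms together with idempotence $a\oplus a=a$, i.e. they are equal as formal polynomials over the tropical semiring (not merely as functions); for $\mathrm{Trop}(f)$ and $\mathrm{Trop}(g)$ this means that $f$ and $g$ have the same set of exponent vectors of monomials with nonzero coefficient. An arithmetic circuit is a circuit whose inputs are each labelled by a single variable $x_i$ or a fixed constant, in which each gate performs a single $\oplus$ or $\odot$ operation (on two previously computed values or inputs; values may be reused), and which has one output. A circuit $C$ computes a tropical polynomial $\mathrm{res}(C)$ in $x_1,\dots,x_n$, and it evaluates a tropical polynomial $g$ if $\mathrm{res}(C)=g$ as tropical polynomials. The tropical semiring complexity of $g$ is the smallest number of gates in a circuit evaluating $g$. *)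

(* Defs.v *)
From HB Require Import structures.
From mathcomp Require Import all_boot all_order all_algebra.
From mathcomp Require Import finmap mpoly complex.
From mathcomp Require Import reals.

Set Implicit Arguments.
Unset Strict Implicit.
Unset Printing Implicit Defensive.

Import Order.TTheory GRing.Theory Num.Theory.
Local Open Scope ring_scope.

(* Partitions of d are written with exactly d parts, padded by zeros, so that
   they form a finite type. *)

Definition is_part (d : nat) (mu : d.-tuple 'I_d.+1) : bool :=
  sorted geq (map val mu) && (sumn (map val mu) == d).

Record par (d : nat) :=
  Par { parval :> d.-tuple 'I_d.+1; parvalP : is_part parval }.

HB.instance Definition _ d := [isSub for @parval d].
HB.instance Definition _ d := [Finite of par d by <:].

(* 0-based: [part mu i] is mu_(i+1), and it is 0 beyond the last part. *)
Definition part d (mu : par d) (i : nat) : nat := nth 0%N (map val mu) i.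

Definition dominance_le d (mu la : par d) : Prop :=
  forall k : nat, (\sum_(i < k) part mu i <= \sum_(i < k) part la i)%N.

(* Cells (row, column), 0-based, of the Young diagram of mu. *)
Definition cell d (mu : par d) := {c : 'I_d * 'I_d | (c.2 < part mu c.1)%N}.

Definition ssyt d (mu : par d) n (T : {ffun cell mu -> 'I_n}) : bool :=
  [forall a : cell mu, forall b : cell mu,
     ((val a).1 == (val b).1) && ((val a).2 <= (val b).2)%N ==> (T a <= T b)%N]
  && [forall a : cell mu, forall b : cell mu,
     ((val a).2 == (val b).2) && ((val a).1 < (val b).1)%N ==> (T a < T b)%N].

Definition schur (K : comNzRingType) (n d : nat) (mu : par d) : {mpoly K[n]} :=
  \sum_(T : {ffun cell mu -> 'I_n} | ssyt T)
     \prod_(i < n) 'X_i ^+ #|[set c | T c == i]|.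

Definition dominated (K : numFieldType) n d (f : {mpoly K[n]}) (la : par d) :
    Prop :=
  f \is d.-homog /\
  exists c : par d -> K,
    [/\ forall mu, 0 <= c mu,
        f = \sum_(mu : par d) c mu *: schur K n mu,
        c la != 0
      & forall mu, c mu != 0 -> dominance_le mu la].

(* The tropical semiring: the reals together with -oo, which is [None]. Below,
   the ring notations 0, 1, +, * on [tropical R] stand for -oo, the real 0, max
   and the addition of reals. *)

Definition tropical (R : realType) : Type := option R.

Section TropicalSemiring.
Variable R : realType.
Implicit Types a b : tropical R.

HB.instance Definition _ := Choice.on (tropical R).

Definition oplus a b : tropical R :=
  match a, b with
  | Some x, Some y => Some (Num.max x y)
  | Some x, None => Some x
  | None, _ => b
  end.

Definition odot a b : tropical R :=
  match a, b with
  | Some x, Some y => Some (x + y)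
  | _, _ => None
  end.

Fact oplusA : associative oplus.
Proof. by move=> [x|] [y|] [z|] //=; rewrite maxA. Qed.

Fact oplusC : commutative oplus.
Proof. by move=> [x|] [y|] //=; rewrite maxC. Qed.

Fact oplus0 : left_id None oplus.
Proof. by case. Qed.

HB.instance Definition _ :=
  GRing.isNmodule.Build (tropical R) oplusA oplusC oplus0.

Fact odotA : associative odot.
Proof. by move=> [x|] [y|] [z|] //=; rewrite addrA. Qed.

Fact odotC : commutative odot.
Proof. by move=> [x|] [y|] //=; rewrite addrC. Qed.

Fact odot1 : left_id (Some 0) odot.
Proof. by move=> [x|] //=; rewrite add0r. Qed.

Fact odotDl : left_distributive odot oplus.
Proof. by move=> [x|] [y|] [z|] //=; rewrite addr_maxl. Qed.

Fact odot0 : left_zero None odot.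
Proof. by []. Qed.

Fact trop1_neq0 : Some 0 != None :> tropical R.
Proof. by []. Qed.

HB.instance Definition _ := GRing.Nmodule_isComNzSemiRing.Build (tropical R)
  odotA odotC odot1 odotDl odot0 trop1_neq0.

End TropicalSemiring.

(* Formal tropical polynomials: finitely supported families of coefficients,
   an absent monomial having coefficient -oo. ({mpoly _} needs a ring of
   coefficients.) *)

Definition tpoly (R : realType) (n : nat) : Type :=
  {fsfun 'X_{1..n} -> tropical R with 0}.

Section TropicalPolynomials.
Variables (R : realType) (n : nat).
Implicit Types p q : tpoly R n.

Definition tpolyC (c : tropical R) : tpoly R n :=
  [fsfun m in [fset 0%MM]%fset => c | 0].

Definition tpolyX (i : 'I_n) : tpoly R n :=
  [fsfun m in [fset U_(i)%MM]%fset => 1 | 0].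

Definition tpoly_oplus p q : tpoly R n :=
  [fsfun m in (finsupp p `|` finsupp q)%fset => p m + q m | 0].

Definition tpoly_odot p q : tpoly R n :=
  [fsfun m in [fset (a + b)%MM | a in finsupp p, b in finsupp q]%fset =>
     \sum_(a <- finsupp p) \sum_(b <- finsupp q | (a + b)%MM == m) p a * q b
   | 0].

End TropicalPolynomials.

Definition Trop (R : realType) n (f : {mpoly R[i][n]}) : tpoly R n :=
  [fsfun m in [fset m in msupp f]%fset => 1 | 0].

Section Circuits.
Variables (R : realType) (n : nat).

Inductive operand :=
  | InVar of 'I_n
  | InConst of tropical R
  | Wire of nat.  (* the value computed by the gate of that (0-based) index *)

Inductive operation := Oplus | Odot.

Record gate := Gate { gate_op : operation; arg1 : operand; arg2 : operand }.

Definition operand_wf (k : nat) (o : operand) : bool :=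
  if o is Wire j then (j < k)%N else true.

(* The gates [gs] are preceded by k other gates. *)
Fixpoint gates_wf (k : nat) (gs : seq gate) : bool :=
  if gs is g :: gs' then
    [&& operand_wf k (arg1 g), operand_wf k (arg2 g) & gates_wf k.+1 gs']
  else true.

Record circuit := Circuit {
  gates : seq gate;
  output : operand;
  circuit_wf : gates_wf 0 gates && operand_wf (size gates) output }.

Definition operand_val (vals : seq (tpoly R n)) (o : operand) : tpoly R n :=
  match o with
  | InVar i => tpolyX R i
  | InConst c => tpolyC n c
  | Wire j => nth (tpolyC n 0) vals j
  end.

Definition gate_val (vals : seq (tpoly R n)) (g : gate) : tpoly R n :=
  let p := operand_val vals (arg1 g) in
  let q := operand_val vals (arg2 g) in
  match gate_op g with
  | Oplus => tpoly_oplus p q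
  | Odot => tpoly_odot p q
  end.

Definition res (C : circuit) : tpoly R n :=
  operand_val
    (foldl (fun vals g => rcons vals (gate_val vals g)) [::] (gates C))
    (output C).

Definition has_tropical_complexity (g : tpoly R n) (k : nat) : Prop :=
  (exists2 C : circuit, res C = g & size (gates C) = k) /\
  (forall C : circuit, res C = g -> (k <= size (gates C))%N).

End Circuits.

(* Main.v *)
Require Import Defs.
From mathcomp Require Import all_boot all_order all_algebra.
From mathcomp Require Import finmap mpoly complex.
From mathcomp Require Import reals boolp.
From mathcomp Require Import zify.

(* By positivity the support of f is the union of the supports of the Schur
   polynomials s_mu with c_mu <> 0. An exponent m occurs in s_mu iff |m| = d
   and m(I) <= mu_1 + ... + mu_|I| for every set I of variables, so supports
   grow with the dominance order and f has the support of s_la. The same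
   exponents are the sums over the columns j of indicator vectors of sets of
   size mu'_j: the columns of a tableau give such sets, such sums satisfy the
   inequalities, and the inequalities let one build a tableau letter by letter.
   Hence Trop(s_la) is the tropical product, over the la_1 columns, of elementary
   symmetric polynomials; all of these together take 2 n^2 gates by
   e_k(x_1, ..., x_i) = e_k(x_1, ..., x_(i-1)) + x_i e_(k-1)(x_1, ..., x_(i-1)),
   and their product takes la_1 more gates. *)

Set Implicit Arguments.
Unset Strict Implicit.
Unset Printing Implicit Defensive.

Import Order.TTheory GRing.Theory Num.Theory.
Local Open Scope ring_scope.

(** * Sums over initial segments, and tableaux with prescribed content *)

Section NatSums.
Local Open Scope nat_scope.

Lemma sum_widen_zero (F : nat -> nat) n N : n <= N ->
  (forall i, n <= i -> F i = 0) -> \sum_(i < N) F i = \sum_(i < n) F i.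
Proof.
move=> nN F0; rewrite -!(big_mkord xpredT F) (big_cat_nat (n := n)) //=.
rewrite [X in _ + X]big_nat_cond [X in _ + X]big1 ?addn0 // => i.
by case/andP => /andP[/F0].
Qed.

Lemma sum_indicator_lt n k : \sum_(i < n) (i < k) = minn n k.
Proof.
by elim: n => [|n IHn]; rewrite ?big_ord0 ?min0n // big_ord_recr /= IHn; lia.
Qed.

Lemma sum_ord_recr_cond (F : nat -> nat) (P : pred nat) n :
  \sum_(i < n.+1 | P i) F i = \sum_(i < n | P i) F i + P n * F n.
Proof. by rewrite big_mkcond big_ord_recr -big_mkcond /= mulnbl. Qed.

(* What remains of [la] after removing a horizontal strip of size [r] taken from
   the lowest possible rows: the most dominant choice. *)
Definition strip_rest (la : nat -> nat) r i :=
  minn (la i) (maxn (la i.+1) (la i + la i.+1 - r)).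

(** Rows with [la i < r] shrink to [la i.+1], rows with [r <= la i.+1] stay whole, and at most one
    row lies between these cases. The first term is the minimum exactly when [r <= la k]. *)
Lemma sum_strip_rest la r k : (forall i j, i <= j -> la j <= la i) -> r <= la 0 ->
  \sum_(i < k) strip_rest la r i =
  minn (\sum_(i < k) la i) (\sum_(i < k.+1) la i - r).
Proof.
move=> la_anti r_le; elim: k => [|k IHk].
  by rewrite !big_ord0 min0n.
rewrite [LHS]big_ord_recr /= {}IHk 2![in RHS]big_ord_recr [in RHS]big_ord_recr /=.
rewrite [\sum_(i < k.+1) la i]big_ord_recr /= /strip_rest.
have := la_anti _ _ (leqnSn k).
have r_le' : k = 0 \/ r <= \sum_(i < k) la i.
  case: k => [|k]; [by left|right].
  by rewrite big_ord_recl (leq_trans r_le) // leq_addr.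
case: r_le' => [k0|]; last first.
  by move: (\sum_(i < k) la i) (la k) (la k.+1) => S a b; lia.
by rewrite k0 big_ord0; move: r_le; rewrite -k0; move: (la k) (la k.+1) => a b; lia.
Qed.

(** Induction on the number of letters: the largest letter fills the strip cut off by [strip_rest],
    and the remaining shape is dominant enough for the inequalities of the other letters. Rows and
    columns are plain numbers, so the shape can change without dependent types. *)
Lemma exists_tableau n (m la : nat -> nat) :
    (forall i j, i <= j -> la j <= la i) -> (forall i, n <= i -> la i = 0) ->
    \sum_(i < n) m i = \sum_(i < n) la i ->
    (forall P : pred nat, \sum_(i < n | P i) m i <=
       \sum_(i < \sum_(i < n | P i) 1) la i) ->
  exists T : nat -> nat -> nat,
  [/\ forall r c, c < la r -> T r c < n,
      forall r c c', c <= c' -> c' < la r -> T r c <= T r c',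
      forall r r' c, r < r' -> c < la r' -> T r c < T r' c
    & forall i, i < n -> \sum_(r < n) \sum_(c < la r) (T r c == i) = m i].
Proof.
elim: n m la => [|n IHn] m la la_anti la0 sum_m m_le.
  by exists (fun _ _ => 0); split=> // [r c|r r' c _]; rewrite la0.
have sumP0 F (P : pred nat) : (forall i, i < n -> P i = false) ->
    \sum_(i < n | P i) F i = 0.
  by move=> P0; apply: big_pred0 => i; apply: P0.
have sumPT F (P : pred nat) : (forall i, i < n -> P i) ->
    \sum_(i < n | P i) F i = \sum_(i < n) F i.
  by move=> PT; apply: eq_bigl => i; apply: PT.
have r_le : m n <= la 0.
  have := m_le (pred1 n); rewrite (sum_ord_recr_cond m (pred1 n)).
  rewrite (sum_ord_recr_cond (fun=> 1) (pred1 n)).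
  have neqn i : i < n -> pred1 n i = false by move/ltn_eqF.
  by rewrite !(sumP0 _ _ neqn) /= eqxx mul1n !add0n big_ord1.
(* Together with [sum_m] this gives [la n <= m n], so row n lies wholly in the strip. *)
have n_le : \sum_(i < n) m i <= \sum_(i < n) la i.
  have := m_le (gtn n); rewrite (sum_ord_recr_cond m (gtn n)).
  rewrite (sum_ord_recr_cond (fun=> 1) (gtn n)) /= ltnn.
  rewrite (sumPT (fun i => m i) (gtn n)) // (sumPT (fun=> 1) (gtn n)) //.
  by rewrite sum_nat_const card_ord muln1 !addn0.
pose nu := strip_rest la (m n).
have nu_le i : nu i <= la i by exact: geq_minl.
have nu_ge i : la i.+1 <= nu i.
  by rewrite leq_min la_anti // leq_max leqnn.
have sum_nu k := sum_strip_rest k la_anti r_le.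
have [||||T [T_lt T_row T_col T_cnt]] := IHn m nu.
- move=> i j; rewrite leq_eqVlt => /predU1P[->//|ij].
  by rewrite (leq_trans (nu_le j)) // (leq_trans _ (nu_ge i)) // la_anti.
- move=> i ni; rewrite /nu /strip_rest (la0 i.+1) //.
  have : la i <= m n; last by lia.
  apply: leq_trans (la_anti _ _ ni) _.
  by move: sum_m n_le; rewrite !big_ord_recr /=; lia.
- by rewrite sum_nu -sum_m big_ord_recr /= addnK; apply/esym/minn_idPr.
(* The two terms of the minimum come from the hypotheses for P without n and for P with n. Since P
   is a predicate on all numbers, its value at n has to be overridden both times. *)
- move=> P; rewrite sum_nu leq_min.
  have := m_le (fun i => (i < n) && P i).
  have := m_le (fun i => (i == n) || P i).
  rewrite (sum_ord_recr_cond m (fun i => (i == n) || P i)).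
  rewrite (sum_ord_recr_cond (fun=> 1) (fun i => (i == n) || P i)).
  rewrite (sum_ord_recr_cond m (fun i => (i < n) && P i)).
  rewrite (sum_ord_recr_cond (fun=> 1) (fun i => (i < n) && P i)).
  rewrite eqxx ltnn /= !addn0 addn1.
  have orE F : \sum_(i < n | (i == n :> nat) || P i) F i =
      \sum_(i < n | P i) F i :> nat.
    by apply: eq_bigl => i; rewrite ltn_eqF.
  have andE F : \sum_(i < n | (i < n) && P i) F i =
      \sum_(i < n | P i) F i :> nat.
    by apply: eq_bigl => i; rewrite ltn_ord.
  rewrite !orE !andE mul1n => le1 ->; rewrite andTb.
  by rewrite -(leq_add2r (m n)) subnK ?(leq_trans _ le1) ?leq_addl.
have nun : nu n = 0.
  have := n_le; rewrite /nu /strip_rest (la0 n.+1) //.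
  move: sum_m; rewrite !big_ord_recr /=; lia.
exists (fun r c => if c < nu r then T r c else n); split.
- move=> r c _; case: ifP => // /T_lt; lia.
- move=> r c c' cc' c'la; case: ifP => c_nu; case: ifP => c'_nu //.
  + exact: T_row.
  + exact/ltnW/T_lt.
  + by rewrite (leq_ltn_trans cc') in c_nu.
- move=> r r' c rr' cla.
  (* A cell with a cell of [la] below it is outside the strip, because [la r.+1 <= nu r]; hence no
     column contains the largest letter twice. *)
  have cnu : c < nu r.
    by apply: leq_trans (nu_ge r); apply: leq_trans cla (la_anti _ _ rr').
  by rewrite cnu; case: ifP => [c_nu'|_]; [apply: T_col|apply: T_lt].
have row_cnt r i : \sum_(c < la r) ((if c < nu r then T r c else n) == i) =
    \sum_(c < nu r) (T r c == i) + (la r - nu r) * (n == i).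
  pose F c := nat_of_bool ((if c < nu r then T r c else n) == i).
  rewrite -(big_mkord xpredT F) (big_cat_nat (n := nu r)) //=; congr (_ + _).
    by rewrite big_mkord; apply: eq_bigr => c _; rewrite /F ltn_ord.
  rewrite -sum_nat_const_nat; apply: eq_big_nat => c /andP[+ _].
  by rewrite leqNgt /F => /negbTE->.
move=> i; rewrite ltnS leq_eqVlt => /predU1P[->|i_lt].
  under eq_bigr do rewrite row_cnt eqxx muln1.
  have T0 (r : 'I_n.+1) : \sum_(c < nu r) (T r c == n) = 0.
    by apply: big1 => c _; rewrite ltn_eqF // T_lt.
  under eq_bigr do rewrite T0 add0n.
  rewrite sumnB => [|r _]; last exact: nu_le.
  rewrite -sum_m [\sum_(i < n.+1) nu i]big_ord_recr /= nun addn0.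
  rewrite sum_nu -sum_m big_ord_recr /= addnK (minn_idPr _) //.
  by rewrite addKn.
under eq_bigr do rewrite row_cnt (gtn_eqF i_lt) muln0 addn0.
by rewrite big_ord_recr /= T_cnt // nun big_ord0 addn0.
Qed.

Lemma sum_ord_mono (F : nat -> nat) n N : n <= N ->
  \sum_(i < n) F i <= \sum_(i < N) F i.
Proof.
move=> nN; rewrite -!(big_mkord xpredT F).
by rewrite [leqRHS](big_cat_nat (n := n)) //= leq_addr.
Qed.

Lemma sum_indicator_eq n j : \sum_(i < n) (i == j :> nat) = (j < n).
Proof. by elim: n => [|n IHn]; rewrite ?big_ord0 // big_ord_recr /= IHn; lia. Qed.

(** The predicate holds on an initial segment, whose length is the first argument of [minn]. *)
Lemma sum_antitone_pred (b : pred nat) d k :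
    (forall i j, i <= j -> b j -> b i) -> (forall i, d <= i -> b i = false) ->
  \sum_(i < k) b i = minn (\sum_(i < d) b i) k.
Proof.
move=> b_anti b0; elim: k => [|k IHk]; first by rewrite big_ord0 minn0.
rewrite big_ord_recr /= IHk; case: (boolP (b k)) => bk.
  have kd : k < d by rewrite ltnNge; apply: contraL bk => /b0->.
  suff : k.+1 <= \sum_(i < d) b i by move: (\sum_(i < d) _) => S /=; lia.
  rewrite -{1}(minn_idPr kd) -sum_indicator_lt; apply: leq_sum => i _.
  by case: ltnP => // ik; rewrite (b_anti _ k ik bk).
suff : \sum_(i < d) b i <= k by move: (\sum_(i < d) _) => S /=; lia.
apply: leq_trans (geq_minr d k); rewrite -sum_indicator_lt; apply: leq_sum => i _.
by case: ltnP => ki; [exact: leq_b1|rewrite (contraNF (b_anti _ _ ki) bk)].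
Qed.

End NatSums.

(** * Tropical polynomials given by sets of exponents *)

Section Indicator.
Variables (R : realType) (n : nat).
Implicit Types A B : {fset 'X_{1..n}}.

Definition trop_bool (b : bool) : tropical R := if b then 1 else 0.

Lemma trop_boolD b c : trop_bool b + trop_bool c = trop_bool (b || c).
Proof.
case: b c => -[] /=; rewrite /trop_bool ?addr0 ?add0r //.
by rewrite /GRing.add /= /GRing.one /= maxxx.
Qed.

Lemma trop_boolM b c : trop_bool b * trop_bool c = trop_bool (b && c).
Proof. by case: b c => -[] /=; rewrite /trop_bool ?mul0r ?mulr0 ?mul1r. Qed.

Lemma trop_bool_sum (I : Type) (s : seq I) (P b : pred I) :
  \sum_(i <- s | P i) trop_bool (b i) = trop_bool (has (predI P b) s).
Proof.
elim: s => [|i s IHs]; first by rewrite big_nil.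
by rewrite big_cons /= IHs; case: (P i); rewrite ?trop_boolD.
Qed.

(** The coefficient is the real 0 (written [1]) on [A] and -oo (written [0]) elsewhere. On such
    polynomials the gates act as union and Minkowski sum. *)
Definition tpoly_ind A : tpoly R n := [fsfun m in A => 1 | 0].

Lemma tpoly_indE A m : tpoly_ind A m = trop_bool (m \in A).
Proof. by rewrite fsfunE. Qed.

Lemma finsupp_ind A : finsupp (tpoly_ind A) = A.
Proof.
by apply/fsetP => m; rewrite mem_finsupp tpoly_indE; case: (m \in A).
Qed.

Definition sumset A B := [fset (a + b)%MM | a in A, b in B]%fset.

Lemma tpoly_oplus_ind A B :
  tpoly_oplus (tpoly_ind A) (tpoly_ind B) = tpoly_ind (A `|` B)%fset.
Proof.
apply/fsfunP => m; rewrite fsfunE !finsupp_ind !tpoly_indE trop_boolD in_fsetU.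
by case: (_ || _).
Qed.

Lemma tpoly_odot_ind A B :
  tpoly_odot (tpoly_ind A) (tpoly_ind B) = tpoly_ind (sumset A B).
Proof.
apply/fsfunP => m; rewrite fsfunE !finsupp_ind tpoly_indE -/(sumset A B).
case: ifP => // /imfset2P[a /= aA [b /= bB mE]].
under eq_bigr => x _.
  under eq_bigr => y _ do rewrite !tpoly_indE trop_boolM.
  rewrite trop_bool_sum.
  over.
rewrite trop_bool_sum; case: hasP => // -[]; exists a => //=.
by apply/hasP; exists b; rewrite //= -mE eqxx aA.
Qed.

Lemma tpolyC1_ind : tpolyC n 1 = tpoly_ind [fset 0%MM]%fset.
Proof. by []. Qed.

Lemma tpolyC0_ind : tpolyC n 0 = tpoly_ind fset0.
Proof.
apply/fsfunP => m; rewrite fsfunE tpoly_indE in_fset0.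
by case: ifP.
Qed.

Lemma Trop_ind (f : {mpoly R[i][n]}) :
  Trop f = tpoly_ind [fset m in msupp f]%fset.
Proof. by []. Qed.

End Indicator.

(** * Gate counts for families of tropical polynomials *)

Section Circuits.
Variables (R : realType) (n : nat).
Implicit Types (gs : seq (gate R n)) (p q : tpoly R n).

Definition gates_val gs : seq (tpoly R n) :=
  foldl (fun vals g => rcons vals (gate_val vals g)) [::] gs.

Lemma gates_val_rcons gs g :
  gates_val (rcons gs g) = rcons (gates_val gs) (gate_val (gates_val gs) g).
Proof. exact: foldl_rcons. Qed.

Lemma size_gates_val gs : size (gates_val gs) = size gs.
Proof.
elim/last_ind: gs => [//|gs g IHgs].
by rewrite gates_val_rcons !size_rcons IHgs.
Qed.

Lemma gates_wf_rcons k gs g : gates_wf k (rcons gs g) =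
  [&& gates_wf k gs, operand_wf (k + size gs) (arg1 g)
    & operand_wf (k + size gs) (arg2 g)].
Proof.
elim: gs k => [|h gs IHgs] k /=; first by rewrite addn0 andbT.
by rewrite IHgs addSnnS !andbA.
Qed.

Definition available gs p :=
  exists2 o, operand_wf (size gs) o & operand_val (gates_val gs) o = p.

Definition is_input p :=
  (exists i, p = tpolyX R i) \/ (exists c, p = tpolyC n c).

Lemma available_input gs p : is_input p -> available gs p.
Proof.
by move=> [[i ->]|[c ->]]; [exists (InVar R i)|exists (InConst n c)].
Qed.

Lemma available_rcons gs g p : available gs p -> available (rcons gs g) p.
Proof.
move=> [o owf <-]; exists o; rewrite ?gates_val_rcons.
  by case: o owf => //= j jlt; rewrite size_rcons ltnW.
by case: o owf => //= j jlt; rewrite nth_rcons size_gates_val jlt.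
Qed.

(** One list of gates serves all members of [P] at once, so that shared intermediate values are
    counted only once. *)
Definition reach N (P : tpoly R n -> Prop) := exists gs,
  [/\ gates_wf 0 gs, (size gs <= N)%N & forall p, P p -> available gs p].

Lemma reach0 (P : tpoly R n -> Prop) : (forall p, P p -> is_input p) ->
  reach 0 P.
Proof. by move=> PI; exists [::]; split=> // p /PI/available_input. Qed.

Lemma reach_sub N M (P Q : tpoly R n -> Prop) : (N <= M)%N -> reach N P ->
  (forall p, Q p -> P p \/ is_input p) -> reach M Q.
Proof.
move=> NM [gs [wf sz av]] QP; exists gs; split=> //; first exact: leq_trans NM.
by move=> p /QP[/av //|/available_input].
Qed.

Lemma reach_op N (P : tpoly R n -> Prop) (op : operation) p q :
  P p \/ is_input p -> P q \/ is_input q -> reach N P ->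
  reach N.+1 (fun r => P r \/
    r = if op is Oplus then tpoly_oplus p q else tpoly_odot p q).
Proof.
move=> Pp Pq [gs [wf sz av]].
have {}av r : P r \/ is_input r -> available gs r.
  by move=> [/av //|/available_input].
have [o1 wf1 v1] := av _ Pp; have [o2 wf2 v2] := av _ Pq.
exists (rcons gs (Gate op o1 o2)).
split; rewrite ?gates_wf_rcons ?size_rcons ?wf /= ?add0n ?wf1 //.
move=> r [Pr|->]; first by apply: available_rcons; apply: av; left.
exists (Wire R n (size gs)); first by rewrite /= size_rcons.
rewrite /= gates_val_rcons nth_rcons size_gates_val ltnn eqxx.
by rewrite /gate_val /= v1 v2; case: op.
Qed.

Lemma reach_union N (P : tpoly R n -> Prop) A B :
  P (tpoly_ind R A) \/ is_input (tpoly_ind R A) ->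
  P (tpoly_ind R B) \/ is_input (tpoly_ind R B) ->
  reach N P -> reach N.+1 (fun p => P p \/ p = tpoly_ind R (A `|` B)%fset).
Proof.
by rewrite -tpoly_oplus_ind => PA PB /(reach_op Oplus PA PB).
Qed.

Lemma reach_sumset N (P : tpoly R n -> Prop) A B :
  P (tpoly_ind R A) \/ is_input (tpoly_ind R A) ->
  P (tpoly_ind R B) \/ is_input (tpoly_ind R B) ->
  reach N P -> reach N.+1 (fun p => P p \/ p = tpoly_ind R (sumset A B)).
Proof.
by rewrite -tpoly_odot_ind => PA PB /(reach_op Odot PA PB).
Qed.

(** The sizes of circuits for [p] form a nonempty set; its minimum is taken after making membership
    Boolean classically. *)
Lemma reach_complexity N p : reach N (eq p) ->
  exists2 k, has_tropical_complexity p k & (k <= N)%N.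
Proof.
move=> [gs [wf sz /(_ p erefl)[o owf oE]]].
have wfC : gates_wf 0 gs && operand_wf (size gs) o by rewrite wf.
pose ok k := exists2 C : circuit R n, res C = p & size (gates C) = k.
have ex : exists k, `[< ok k >].
  by exists (size gs); apply/asboolP; exists (Circuit wfC).
have [k /asboolP okk kmin] := ex_minnP ex.
have kle (C : circuit R n) : res C = p -> (k <= size (gates C))%N.
  by move=> CE; apply: kmin; apply/asboolP; exists C.
exists k => //; apply: leq_trans sz.
exact: (kle (Circuit wfC)).
Qed.

End Circuits.

(** * Supports of elementary symmetric polynomials and of their products *)

Section ElementarySupport.
Variable n : nat.
Implicit Types (s : seq 'I_n) (m : 'X_{1..n}).

Lemma in_sumset (A B : {fset 'X_{1..n}}) m :
  reflect (exists a b, [/\ a \in A, b \in B & m = (a + b)%MM]) (m \in sumset A B).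
Proof.
apply: (iffP idP) => [/imfset2P[a /= aA [b /= bB ->]]|[a [b [aA bB ->]]]].
  by exists a, b.
by apply/imfset2P; exists a => //; exists b.
Qed.

(* Exponents of the elementary symmetric polynomial of degree [k] in the
   variables [s]. *)
Fixpoint esupp s k : {fset 'X_{1..n}} :=
  match s, k with
  | _, 0 => [fset 0%MM]%fset
  | [::], _.+1 => fset0
  | i :: s', k'.+1 =>
    (esupp s' k'.+1 `|` sumset [fset U_(i)%MM]%fset (esupp s' k'))%fset
  end.

(** The two branches of the recursion separate exponent 0 from exponent 1 in the head variable;
    [uniq s] keeps the second branch squarefree. *)
Lemma mem_esupp s k m : uniq s ->
  (m \in esupp s k) = (mdeg m == k) && [forall i, m i <= (i \in s)]%N.
Proof.
elim: s k m => [|j s IHs] [|k] m /= us.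
- rewrite in_fset1 -mdeg_eq0 mdegE; apply/idP/andP => [/eqP m0|[]//].
  rewrite m0; split=> //; apply/forallP => i.
  by move/eqP: m0; rewrite sum_nat_eq0 => /forallP/(_ i)/eqP/= ->.
- rewrite in_fset0; apply/esym/negbTE/negP => /andP[/eqP + /forallP m0].
  by rewrite mdegE big1 // => i _; apply/eqP; rewrite -leqn0; apply: m0.
- rewrite in_fset1 -mdeg_eq0; case: eqP => //= /eqP.
  rewrite mdeg_eq0 => /eqP ->; apply/esym/forallP => i.
  by rewrite mnm0E.
case/andP: us => js us; rewrite in_fsetU IHs //.
apply/orP/andP => [[/andP[-> /forallP ms]|]|[mk /forallP ms]].
- split=> //; apply/forallP => i; apply: leq_trans (ms i) _.
  by rewrite inE; case: (i \in s); rewrite ?orbT.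
- move=> /in_sumset[_ [b [/fset1P -> + ->]]]; rewrite IHs // mdegD mdeg1.
  move=> /andP[/eqP-> /forallP ms]; split=> //; apply/forallP => i.
  rewrite mnmDE mnm1E inE eq_sym; have := ms i.
  by case: eqP => // ->; rewrite (negbTE js) => /=; lia.
case: (posnP (m j)) => mj.
- left; rewrite mk; apply/forallP => i; have := ms i; rewrite inE.
  by case: eqP => // ->; rewrite mj.
right; apply/in_sumset; exists U_(j)%MM, (m - U_(j))%MM.
have le_jm : (U_(j) <= m)%MM.
  by apply/mnm_lepP => i; rewrite mnm1E; case: eqP => // ji; rewrite -ji.
split; rewrite ?fset11 //; last by rewrite addmC submK.
rewrite IHs // -eqSS -(eqP mk) -[in X in _ == X](submK le_jm) mdegD mdeg1 addn1 eqxx.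
apply/forallP => i; rewrite mnmBE mnm1E; have := ms i; rewrite inE eq_sym.
by case: eqP => [<-|_] /=; rewrite ?(negbTE js) ?subn0 ?leq_subLR ?addn0.
Qed.

Lemma esuppP k m : reflect (exists2 h : {set 'I_n}, m = mesym1 h & #|h| = k)
  (m \in esupp (enum 'I_n) k).
Proof.
rewrite mem_esupp ?enum_uniq //.
apply: (iffP andP) => [[/eqP mk /forallP m1]|[h -> <-]].
  have mE : m = mesym1 [set i | m i != 0%N].
    apply/mnmP => i; rewrite mnmE inE; have := m1 i; rewrite mem_enum.
    by case: (m i) => [|[]].
  by exists [set i | m i != 0%N]; rewrite -?mdeg_mesym1 -?mE.
split; first by rewrite mdeg_mesym1.
by apply/forallP => i; rewrite mnmE mem_enum leq_b1.
Qed.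

Definition esupp_prod (ks : seq nat) : {fset 'X_{1..n}} :=
  foldr (fun k => sumset (esupp (enum 'I_n) k)) [fset 0%MM]%fset ks.

Lemma esupp_prodP ks m :
  reflect (exists2 hs : seq {set 'I_n}, m = (\sum_(h <- hs) mesym1 h)%MM
             & [seq #|pred_of_set h| | h <- hs] = ks)
    (m \in esupp_prod ks).
Proof.
elim: ks m => [|k ks IHks] m /=.
  apply: (iffP idP) => [/fset1P ->|[[|//] -> _]]; last by rewrite big_nil fset11.
  by exists [::]; rewrite ?big_nil.
apply: (iffP (in_sumset _ _ _)).
  move=> [_ [_ [/esuppP[h -> <-] /IHks[hs -> <-] ->]]].
  by exists (h :: hs); rewrite // big_cons.
move=> [[//|h hs] -> [hk hsk]]; rewrite big_cons.
exists (mesym1 h), (\sum_(h <- hs) mesym1 h)%MM; split=> //.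
  by apply/esuppP; exists h.
by apply/IHks; exists hs.
Qed.

End ElementarySupport.

(** * Circuits for elementary symmetric polynomials and their products *)

Section ElementaryCircuit.
Variables (R : realType) (n : nat).

Lemma esupp0 (s : seq 'I_n) : esupp s 0 = [fset 0%MM]%fset.
Proof. by case: s. Qed.

Lemma is_input_esupp0 (s : seq 'I_n) : is_input (tpoly_ind R (esupp s 0)).
Proof. by right; exists 1; rewrite tpolyC1_ind esupp0. Qed.

(** Each new variable costs one product and one sum for each degree from 1 to K; degree 0 is a
    constant input. *)
Lemma reach_esupp K (s : seq 'I_n) : @reach R n (2 * K * size s)
  (fun p => exists2 k, (k <= K)%N & p = tpoly_ind R (esupp s k)).
Proof.
elim: s => [|i s IHs] /=.
  rewrite muln0; apply: reach0 => p [[|k] _ ->]; first exact: (is_input_esupp0 [::]).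
  by right; exists 0; rewrite tpolyC0_ind.
(* The old values of all degrees are kept while the new ones are added, since degree j+1 uses the
   old values of degrees j+1 and j. *)
suff step j : (j <= K)%N -> reach (2 * K * size s + 2 * j) (fun p =>
    (exists2 k, (k <= K)%N & p = tpoly_ind R (esupp s k)) \/
    (exists2 k, (k <= j)%N & p = tpoly_ind R (esupp (i :: s) k))).
  by apply: reach_sub (step K (leqnn K)) _; [lia|left; right].
elim: j => [|j IHj] jK.
  rewrite muln0 addn0; apply: reach_sub IHs _ => // p [|[k]]; first by left.
  by rewrite leqn0 => /eqP-> ->; right; exact: is_input_esupp0.
apply: (reach_sub _ (reach_union (A := esupp s j.+1)
  (B := sumset [fset U_(i)%MM]%fset (esupp s j)) _ _
  (reach_sumset (A := [fset U_(i)%MM]%fset) (B := esupp s j) _ _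
    (IHj (ltnW jK))))).
- by lia.
- by left; left; left; exists j.+1.
- by left; right.
- by right; left; exists i.
- by left; left; exists j => //; exact: ltnW.
- move=> p [pP|[k kj ->]]; first by left; left; left; left.
  move: kj; rewrite leq_eqVlt => /predU1P[->|kj]; first by left; right.
  by left; left; left; right; exists k.
Qed.

(** The elementary factors stay available along the product, so each further factor costs a single
    gate. *)
Lemma reach_esupp_prod ks : @reach R n (2 * n ^ 2 + size ks)
  (fun p => p = tpoly_ind R (esupp_prod n ks) \/
     exists2 k, (k <= n)%N & p = tpoly_ind R (esupp (enum 'I_n) k)).
Proof.
elim: ks => [|k ks IHks].
  apply: reach_sub (reach_esupp n (enum 'I_n)) _.
    by rewrite size_enum_ord; lia.
  move=> p [->|]; last by left.
  by right; right; exists 1; rewrite tpolyC1_ind.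
(* No set of variables has more than n elements, so a factor of degree above n is the constant -oo,
   which is an input. *)
have kP : (exists2 k', (k' <= n)%N &
    tpoly_ind R (esupp (enum 'I_n) k) = tpoly_ind R (esupp (enum 'I_n) k')) \/
    is_input (tpoly_ind R (esupp (enum 'I_n) k)).
  case: (leqP k n) => kn; [by left; exists k | right; right; exists 0].
  rewrite tpolyC0_ind; congr tpoly_ind; apply/fsetP => m; rewrite in_fset0.
  apply/esuppP => -[h _ hk]; have := max_card (mem h).
  by rewrite hk card_ord leqNgt kn.
apply: (reach_sub _ (reach_sumset (A := esupp (enum 'I_n) k)
  (B := esupp_prod n ks) _ _ IHks)).
- by rewrite /= addnS.
- by case: kP; [left; right|right].
- by left; left.
- by move=> p [->|pP]; left; [right|left; right].
Qed.

(** The Boolean factor records that the empty product is a constant and takes no gate, as the final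
    bound demands when the first part is 0. *)
Lemma esupp_prod_complexity ks : exists2 k,
  has_tropical_complexity (tpoly_ind R (esupp_prod n ks)) k &
  (k <= (2 * n ^ 2 + size ks) * (0 < size ks))%N.
Proof.
case: ks => [|k ks] /=.
  apply: reach_complexity; rewrite muln0; apply: reach0 => p <-.
  by right; exists 1; rewrite tpolyC1_ind.
apply: reach_complexity; rewrite muln1.
by apply: reach_sub (reach_esupp_prod (k :: ks)) _ => // p <-; left; left.
Qed.

End ElementaryCircuit.

(** * Partitions and their conjugates *)

Section Partitions.
Local Open Scope nat_scope.
Variables (d : nat) (mu : par d).

Lemma size_part : size (map val mu) = d.
Proof. by rewrite size_map size_tuple. Qed.

Lemma part_anti i j : i <= j -> part mu j <= part mu i.
Proof.
have /andP[srt _] := parvalP mu.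
move=> ij; rewrite /part; case: (ltnP j d) => jd; last first.
  by rewrite nth_default ?size_part.
have geqT : transitive geq by move=> x y z /= xy /leq_trans; apply.
apply: (sorted_leq_nth geqT leqnn 0 srt) => //; rewrite inE size_part //.
exact: leq_ltn_trans jd.
Qed.

Lemma part0 i : d <= i -> part mu i = 0.
Proof. by move=> di; rewrite /part nth_default ?size_part. Qed.

Lemma sum_part : \sum_(i < d) part mu i = d.
Proof.
have /andP[_ /eqP] := parvalP mu.
by rewrite sumnE (big_nth 0) size_part big_mkord.
Qed.

Lemma part_le i : part mu i <= d.
Proof.
case: (ltnP i d) => [id|/part0->//].
by apply: leq_trans (eq_leq sum_part); rewrite (bigD1 (Ordinal id)) //= leq_addr.
Qed.

Lemma sum_part_ge k : d <= k -> \sum_(i < k) part mu i = d.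
Proof. by move=> dk; rewrite (sum_widen_zero dk) ?sum_part //; apply: part0. Qed.

Lemma sum_part_le k : \sum_(i < k) part mu i <= d.
Proof.
apply: leq_trans (eq_leq (sum_part_ge (leq_maxr k d))).
by rewrite sum_ord_mono // leq_maxl.
Qed.

Definition conj_part j := \sum_(r < d) (j < part mu r).

(** Both sides count the cells in the first k rows, column by column and row by row. *)
Lemma sum_minn_conj_part k :
  \sum_(j < part mu 0) minn (conj_part j) k = \sum_(i < k) part mu i.
Proof.
under eq_bigr => j _.
  rewrite -(sum_antitone_pred (b := fun r => j < part mu r)).
  - over.
  - by move=> r r' rr' /leq_trans; apply; exact: part_anti.
  - by move=> r /part0->.
rewrite exchange_big /=; apply: eq_bigr => r _.
by rewrite sum_indicator_lt; apply/minn_idPr/part_anti.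
Qed.

Lemma sum_cell (F : nat -> nat -> nat) :
  \sum_(c : cell mu) F (val c).1 (val c).2 =
  \sum_(r < d) \sum_(j < part mu r) F r j.
Proof.
under [RHS]eq_bigr => r _ do rewrite (big_ord_widen _ _ (part_le r)).
rewrite pair_big_dep /= .
rewrite (reindex_omap (val : cell mu -> _) insub) /=; last first.
  by move=> c cP; rewrite insubT.
by apply: eq_bigl => c; rewrite (valP c) valK eqxx.
Qed.

End Partitions.

(** * Contents of tableaux, column sums and Rado's inequalities *)

Section Tableaux.
Local Open Scope nat_scope.
Variables (d : nat) (mu : par d) (n : nat).
Implicit Types (T : {ffun cell mu -> 'I_n}) (m : 'X_{1..n}).

Definition content T : 'X_{1..n} := [multinom #|[set c | T c == i]| | i < n].

Definition column_degrees := [seq conj_part mu j | j <- iota 0 (part mu 0)].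

(* Rado's inequalities for the permutohedron of [mu]. *)
Definition rado m := mdeg m = d /\
  forall I : {set 'I_n}, \sum_(i in I) m i <= \sum_(i < #|I|) part mu i.

Lemma contentE T i : content T i = \sum_(c : cell mu) (T c == i).
Proof. by rewrite mnmE cardsE -sum1_card big_mkcond. Qed.

Lemma cell_col_lt (c : cell mu) : (val c).2 < part mu 0.
Proof. exact: leq_trans (valP c) (part_anti mu (leq0n _)). Qed.

(** The entries of a column are distinct, so column j contributes the indicator vector of a set of
    size [conj_part mu j]. *)
Lemma content_column T : ssyt T -> content T \in esupp_prod n column_degrees.
Proof.
move=> /andP[_ /forallP Tcol].
pose col j := [set c : cell mu | (val c).2 == j :> nat].
have Tinj j : {in col j &, injective T}.
  have lt_T a b : a \in col j -> b \in col j -> (val a).1 < (val b).1 -> T a < T b.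
    rewrite !inE => /eqP aj /eqP bj ab.
    have /forallP/(_ b)/implyP := Tcol a; apply.
    by rewrite ab -val_eqE /= aj bj eqxx.
  move=> a b aj bj Tab; apply/val_inj/eqP.
  rewrite -pair_eqE /= -!val_eqE /=; apply/andP; split.
    have := lt_T _ _ aj bj; have := lt_T _ _ bj aj; rewrite Tab ltnn.
    by case: ltngtP => // _ => [/(_ isT)|_ /(_ isT)].
  by move: aj bj; rewrite !inE => /eqP -> /eqP ->.
have card_col j : #|col j| = conj_part mu j.
  rewrite cardsE -sum1_card big_mkcond /=.
  rewrite (sum_cell mu (fun _ c => c == j)); apply: eq_bigr => r _.
  exact: sum_indicator_eq.
apply/esupp_prodP; exists [seq T @: col j | j <- iota 0 (part mu 0)].
  apply/mnmP => i; rewrite contentE mnm_sumE big_map.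
  transitivity (\sum_(j <- iota 0 (part mu 0)) \sum_(c in col j) (T c == i)).
    rewrite (exchange_big_dep xpredT) //=; apply: eq_bigr => c _.
    rewrite -[RHS]big_filter.
    rewrite (_ : [seq _ <- _ | _] = [:: (val c).2 : nat]) ?big_seq1 //.
    transitivity [seq j <- iota 0 (part mu 0) | pred1 ((val c).2 : nat) j].
      by apply: eq_filter => j; rewrite inE eq_sym.
    by rewrite filter_pred1_uniq ?iota_uniq // mem_iota cell_col_lt.
  apply: eq_bigr => j _; rewrite mnmE.
  rewrite -(big_imset (fun x => nat_of_bool (x == i)) (@Tinj j)) /=.
  case: (boolP (i \in _)) => iT.
    by rewrite (big_setD1 i) //= eqxx big1 // => k; rewrite !inE => /andP[/negbTE->].
  by rewrite big1 // => k; case: eqP => // -> /(negP iT).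
rewrite -map_comp; apply: eq_map => j /=.
by rewrite card_in_imset.
Qed.

(** A set of size h meets I in at most min(h, |I|) elements; summing over the columns counts the
    cells in the first |I| rows. *)
Lemma column_rado m : m \in esupp_prod n column_degrees -> rado m.
Proof.
move=> /esupp_prodP[hs -> hsE].
have sum_cols (F : nat -> nat) :
    \sum_(h <- hs) F #|pred_of_set h| = \sum_(j < part mu 0) F (conj_part mu j).
  have := congr1 (map F) hsE; rewrite -!map_comp => /(congr1 sumn).
  rewrite !sumnE !big_map => ->.
  by rewrite -(big_mkord xpredT (F \o conj_part mu)) /index_iota subn0.
split.
  rewrite mdeg_sum; under eq_bigr do rewrite mdeg_mesym1.
  (* For k = d the minimum is the column length itself, since a column has at most d cells. *)
  rewrite (sum_cols id) -[RHS](sum_part mu) -sum_minn_conj_part.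
  apply: eq_bigr => j _; apply/esym/minn_idPl.
  rewrite -[leqRHS]card_ord -sum1_card; apply: leq_sum => r _; exact: leq_b1.
move=> I; under eq_bigr do rewrite mnm_sumE.
rewrite exchange_big -sum_minn_conj_part -(sum_cols (minn ^~ #|I|)) /=.
apply: leq_sum => h _.
under eq_bigr do rewrite mnmE; rewrite -big_mkcondr sum1_card leq_min.
by rewrite !subset_leq_card //; apply/subsetP => i /andP[].
Qed.

Lemma rado_ssyt m : rado m -> exists2 T, ssyt T & content T = m.
Proof.
move=> [md mI].
(* The exponent vector is extended by 0 to all numbers, the form that [exists_tableau] expects. *)
pose m' i := if insub i is Some o then m (o : 'I_n) else 0.
have m'E (i : 'I_n) : m' i = m i by rewrite /m' valK.
have md' : \sum_(i < n) m' i = d by rewrite -md mdegE; apply: eq_bigr.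
(* Rado's inequality for the set of all variables forces the first n rows to hold all d cells. *)
have sum_n : \sum_(i < n) part mu i = d.
  apply/eqP; rewrite eqn_leq sum_part_le -{1}md mdegE.
  apply: leq_trans (eq_leq _) (leq_trans (mI setT) _).
    by apply: eq_bigl => i; rewrite inE.
  by rewrite cardsT card_ord.
have [||||T [T_lt T_row T_col T_cnt]] := @exists_tableau n m' (part mu).
- exact: part_anti.
- move=> i ni; have := sum_part_le mu i.+1; rewrite big_ord_recr /=.
  have := sum_ord_mono (part mu) ni; rewrite sum_n.
  by move: (\sum_(j < i) _) => S; lia.
- by rewrite md' sum_n.
- move=> P; have := mI [set i : 'I_n | P i].
  rewrite cardsE sum1_card; apply: leq_trans; apply: eq_leq.
  by apply: eq_big => [i|i _]; rewrite ?inE.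
pose T' := [ffun c : cell mu => Ordinal (T_lt _ _ (valP c))].
exists T'.
  apply/andP; split; apply/forallP => a; apply/forallP => b; apply/implyP.
    by move=> /andP[/eqP ab1 ab2]; rewrite !ffunE /= ab1 T_row // (valP b).
  by move=> /andP[/eqP ab1 ab2]; rewrite !ffunE /= ab1 T_col // (valP b).
apply/mnmP => i; rewrite contentE -m'E -T_cnt //.
under eq_bigr do rewrite ffunE -val_eqE /=.
rewrite (sum_cell mu (fun r c => T r c == i)).
pose F r := \sum_(c < part mu r) (T r c == i).
(* The diagram is indexed by d rows and the count by n rows; both sums agree with the one over
   max(d, n) rows, the extra rows being empty. *)
rewrite -(@sum_widen_zero F d (maxn d n)) ?leq_maxl //; last first.
  by move=> r /(part0 mu) r0; rewrite /F r0 big_ord0.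
rewrite (@sum_widen_zero F n) ?leq_maxr // => r nr.
have r0 : part mu r = 0.
  have := sum_part_le mu r.+1; rewrite big_ord_recr /=.
  have := sum_ord_mono (part mu) nr; rewrite sum_n.
  by move: (\sum_(j < r) _) => S; lia.
by rewrite /F r0 big_ord0.
Qed.

End Tableaux.

(** * Supports of Schur polynomials and of polynomials dominated by them *)

Section SchurSupport.
Variables (K : numFieldType) (n d : nat).
Implicit Types (mu la : par d) (m : 'X_{1..n}).

Lemma mcoeff_schur mu m : (schur K n mu)@_m =
  #|[set T : {ffun cell mu -> 'I_n} | ssyt T && (content T == m)]|%:R.
Proof.
rewrite cardsE -sum1_card natr_sum big_mkcondr raddf_sum /=.
apply: eq_bigr => T _; rewrite -mulrb.
rewrite (_ : \prod_(i < n) _ = 'X_[content T]) ?mcoeffX //.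
by rewrite mpolyXE_id; apply: eq_bigr => i _; rewrite mnmE.
Qed.

(** The coefficient is a number of tableaux, nonzero in characteristic 0 as soon as one tableau
    exists. *)
Lemma msupp_schurP mu m : reflect (rado mu m) (m \in msupp (schur K n mu)).
Proof.
rewrite mcoeff_msupp mcoeff_schur pnatr_eq0 cards_eq0.
apply: (iffP (set0Pn _)) => [[T]|/rado_ssyt[T ssT TE]].
  rewrite inE => /andP[ssT /eqP <-].
  exact/column_rado/content_column.
by exists T; rewrite inE ssT TE eqxx.
Qed.

Lemma msupp_schur mu :
  [fset m in msupp (schur K n mu)]%fset = esupp_prod n (column_degrees mu).
Proof.
apply/fsetP => m; rewrite inE /=; apply/msupp_schurP/idP; last exact: column_rado.
by move=> /rado_ssyt[T ssT <-]; exact: content_column.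
Qed.

(** Nonnegative terms cannot cancel, and dominance only weakens Rado's inequalities in passing from
    mu to [la]. *)
Lemma msupp_dominated (f : {mpoly K[n]}) la : dominated f la ->
  msupp f =i msupp (schur K n la).
Proof.
move=> [_ [c [c0 -> cla cdom]]] m.
have coeff_ge0 mu : 0 <= c mu * (schur K n mu)@_m.
  by rewrite mulr_ge0 // mcoeff_schur ler0n.
rewrite mcoeff_msupp raddf_sum /=; under eq_bigr do rewrite mcoeffZ.
rewrite psumr_neq0 //; apply/hasP/idP => [[mu _ /andP[_ /gt_eqF/negbT]]|mla].
  rewrite mulf_eq0 negb_or -mcoeff_msupp => /andP[/cdom mula /msupp_schurP[md mI]].
  by apply/msupp_schurP; split=> // I; exact: leq_trans (mI I) (mula _).
exists la; rewrite ?mem_index_enum //= lt0r coeff_ge0 andbT mulf_neq0 //.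
by rewrite -mcoeff_msupp.
Qed.

End SchurSupport.

(** * Equality of tropicalizations and the absolute constant *)

Theorem proposition2p3 :
  exists C : nat,
  forall (R : realType) (n d : nat) (f : {mpoly R[i][n]}) (la : par d),
    (1 <= n)%N -> f \is symmetric -> dominated f la ->
    Trop f = Trop (schur R[i] n la) /\
    exists2 k : nat, has_tropical_complexity (Trop f) k
                   & (k <= C * (n ^ 2 * part la 0))%N.
Proof.
(* For n and the first part l at least 1, 2 n^2 + l is at most 3 n^2 l; for l = 0 no gate is
   used. *)
exists 3%N => R n d f la n_gt0 _ fla.
have TropE : Trop f = Trop (schur R[i] n la).
  rewrite !Trop_ind; congr tpoly_ind; apply/fsetP => m.
  by rewrite !inE /= (msupp_dominated fla).
split=> //; rewrite TropE Trop_ind msupp_schur.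
have [k kP k_le] := esupp_prod_complexity R n (column_degrees la).
exists k => //; apply: leq_trans k_le _; rewrite size_map size_iota.
case: (part la 0) => [|l]; rewrite ?muln0 //= muln1.
have : (1 <= n ^ 2)%N by rewrite expn_gt0 n_gt0.
move: (n ^ 2)%N => N; nia.
Qed.
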